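(* Let $\{S_t:t\in\mathbb{Z}^+\}$ be the observed process of a discrete-time three-state hidden Markov model with 1-step transition probability matrix $P$, stationary distribution $\mu=(\mu_1,\mu_2,\mu_3)$ and state-dependent probability matrix $\Pi$ with columns $\varphi_0,\dots,\varphi_{K-1}$. Let $-\lambda_1,-\lambda_2$ be the nonzero eigenvalues of $Q=P-I$ and $\nu=\mu_1a_2-\mu_2b_1$ the probability flux. Then for all observed states $i,j\in\{0,\dots,K-1\}$ and all positive integers $n$, $$\Pr\{S_0=i,S_n=j\}-\Pr\{S_0=j,S_n=i\}=\frac{\nu A}{\lambda_1-\lambda_2}\left[(1-\lambda_2)^n-(1-\lambda_1)^n\right],$$ where $A=(y_2-x_2)(x_1-z_1)-(x_2-z_2)(y_1-x_1)$, $(x_1,y_1,z_1)'=\varphi_i$ and $(x_2,y_2,z_2)'=\varphi_j$.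
   Context: Discrete-time three-state hidden Markov model: $\{C_t:t\in\mathbb{Z}^+\}$ (times $0,1,2,\dots$) is an irreducible, time-homogeneous Markov chain on $\{1,2,3\}$ with 1-step transition probability matrix $$P=\begin{pmatrix}1-a_2-a_3&a_2&a_3\\ b_1&1-b_1-b_3&b_3\\ c_1&c_2&1-c_1-c_2\end{pmatrix},$$ started from its stationary distribution $\mu=(\mu_1,\mu_2,\mu_3)$, $\mu_i>0$, $\sum_i\mu_i=1$. By stationarity $\mu_1a_2-\mu_2b_1=\mu_2b_3-\mu_3c_2=\mu_3c_1-\mu_1a_3$; this common value is the probability flux $\nu$. The state-dependent probability matrix $\Pi=(\pi(k\,|\,i))$, $i=1,2,3$, $k=0,\dots,K-1$, is a $3\times K$ matrix with nonnegative entries and rows summing to 1; $\varphi_k\in\mathbb{R}^3$ is its column indexed by $k$ and a prime denotes transpose. The observed process $\{S_t\}$ takes values in $\{0,\dots,K-1\}$; conditionally on the hidden state at time $t$, $S_t$ has law $\pi(\cdot\,|\,C_t)$ and is independent of all earlier observations and of the hidden chain before time $t$. Thus for integers $0\le t_1<\cdots<t_n$, $\Pr(S_{t_1}=s_1,\dots,S_{t_n}=s_n)=\mu\Lambda_{s_1}P^{t_2-t_1}\Lambda_{s_2}\cdots P^{t_n-t_{n-1}}\Lambda_{s_n}\vec e$, where $\Lambda_k=\mathrm{diag}(\varphi_k)$, $\vec e=(1,1,1)'$. The eigenvalues of $Q=P-I$ are $0,-\lambda_1,-\lambda_2$, where $\lambda_1,\lambda_2$ are nonzero and possibly complex. When $\lambda_1=\lambda_2$,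 formulas containing $\frac1{\lambda_1-\lambda_2}$ are read as limits $\lambda_2\to\lambda_1$ (so $\frac{(1-\lambda_2)^n-(1-\lambda_1)^n}{\lambda_1-\lambda_2}$ means $n(1-\lambda_1)^{n-1}$). *)

(* Defs.v *)
From HB Require Import structures.
From mathcomp Require Import all_boot all_order all_algebra.
From mathcomp Require Import complex.
From mathcomp Require Import all_classical all_reals all_analysis.

Set Implicit Arguments.
Unset Strict Implicit.
Unset Printing Implicit Defensive.

Import Order.TTheory GRing.Theory Num.Theory.

Local Open Scope classical_set_scope.
Local Open Scope ring_scope.
Local Open Scope complex_scope.

Section Matrices.
Variable R : realType.

(* The hidden states 1, 2, 3 are the elements 0, 1, 2 of 'I_3. *)
Definition trans_mx (a2 a3 b1 b3 c1 c2 : R) : 'M[R]_3 :=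
  \matrix_(i < 3, j < 3)
    nth 0 (nth [::] [:: [:: 1 - a2 - a3; a2;          a3         ];
                        [:: b1;          1 - b1 - b3; b3         ];
                        [:: c1;          c2;          1 - c1 - c2]] i) j.

Definition stochastic m n (M : 'M[R]_(m, n)) : Prop :=
  (forall i j, 0 <= M i j) /\ (forall i, \sum_j M i j = 1).

Definition irreducible_mx (P : 'M[R]_3) : Prop :=
  forall i j, exists2 n : nat, (0 < n)%N & 0 < (P ^+ n) i j.

Definition stationary_distribution (P : 'M[R]_3) (mu : 'rV[R]_3) : Prop :=
  [/\ forall i, 0 < mu 0 i, \sum_i mu 0 i = 1 & mu *m P = mu].

(* [- l1] and [- l2] are the nonzero eigenvalues of the real matrix [Q], over
   the complex numbers and with algebraic multiplicity; 0 is the third one. *)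
Definition nonzero_eigenvalues (Q : 'M[R]_3) (l1 l2 : R[i]) : Prop :=
  [/\ l1 != 0, l2 != 0 &
      char_poly (map_mx (real_complex R) Q) =
      \prod_(z <- [:: 0; - l1; - l2]) ('X - z%:P)].

(* With u = (x1, y1, z1)' and v = (x2, y2, z2)'. *)
Definition coefA (u v : 'cV[R]_3) : R :=
  let x1 := u 0 0 in let y1 := u 1 0 in let z1 := u 2 0 in
  let x2 := v 0 0 in let y2 := v 1 0 in let z2 := v 2 0 in
  (y2 - x2) * (x1 - z1) - (x2 - z2) * (y1 - x1).

(* ((1 - l2)^n - (1 - l1)^n) / (l1 - l2), extended to l1 = l2 by its limit. *)
Definition power_quotient (l1 l2 : R[i]) (n : nat) : R[i] :=
  if l1 == l2 then n%:R * (1 - l1) ^+ n.-1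
  else ((1 - l2) ^+ n - (1 - l1) ^+ n) / (l1 - l2).

End Matrices.

Section HiddenMarkovModel.
Variables (R : realType) (d : measure_display) (T : measurableType d).
Variable Pr : probability T R.

Definition prob (A : set T) : R := fine (Pr A).

Definition cond_prob (A B : set T) : R := prob (A `&` B) / prob B.

(* The event that the processes [C] and [S] follow the paths [c] and [s] at
   the times u < t. *)
Definition history K (C : nat -> T -> 'I_3) (S : nat -> T -> 'I_K)
    (c : nat -> 'I_3) (s : nat -> 'I_K) (t : nat) : set T :=
  [set w | forall u, (u < t)%N -> C u w = c u /\ S u w = s u].

(* [hmm_markov] conditions on the past observations too, so that the hidden
   chain is not influenced by the observed process: this contains the Markov
   property of [C] alone, and without it the joint laws of [S] would not be
   determined by [mu], [P] and [Pi]. Events with a fixed history generate the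
   finite past, so it suffices to condition on them. *)
Record is_hmm K (mu : 'rV[R]_3) (P : 'M[R]_3) (Pi : 'M[R]_(3, K))
    (C : nat -> T -> 'I_3) (S : nat -> T -> 'I_K) : Prop := {
  hmm_measurable_hidden : forall t x, measurable [set w | C t w = x];
  hmm_measurable_observed : forall t k, measurable [set w | S t w = k];
  hmm_initial : forall x, prob [set w | C 0%N w = x] = mu 0 x;
  hmm_markov : forall t c s x,
    prob (history C S c s t.+1) != 0 ->
    cond_prob [set w | C t.+1 w = x] (history C S c s t.+1) = P (c t) x;
  hmm_emission : forall t x k,
    prob [set w | C t w = x] != 0 ->
    cond_prob [set w | S t w = k] [set w | C t w = x] = Pi x k;
  hmm_emission_indep : forall t c s x k,
    prob [set w | C t w = x] != 0 ->
    cond_prob ([set w | S t w = k] `&` history C S c s t) [set w | C t w = x] =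
    cond_prob [set w | S t w = k] [set w | C t w = x] *
    cond_prob (history C S c s t) [set w | C t w = x]
}.

End HiddenMarkovModel.

(* Main.v *)
Require Import Defs.
From mathcomp Require Import all_boot all_order all_algebra.
From mathcomp Require Import complex.
From mathcomp Require Import all_classical all_reals all_analysis.
From mathcomp Require Import ring.

(** By the hidden Markov property, [Pr(S_0 = i, S_n = j)] is the bilinear form
    [sum_(x, y) mu_x Pi_(x i) (P^n)_(x y) Pi_(y j)] in the columns [i] and [j]
    of [Pi] ([prob_observed_pair]), so the difference in the theorem is the
    bilinear form of the antisymmetric matrix [J_n] with entries
    [mu_x (P^n)_(x y) - mu_y (P^n)_(y x)]. Since [P^n] is stochastic and
    preserves [mu], the rows of [J_n] sum to 0. An antisymmetric 3 x 3 matrix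
    with zero row sums is determined by its entry (1, 2): it is that entry, the
    flux of [P^n], times the fixed circulation 1 -> 2 -> 3 -> 1, whose bilinear
    form is the coefficient [A] ([flux_form]).

    It remains to compute the flux of [P^n] ([flux_pow]). Put
    [r1 = 1 - lambda1] and [r2 = 1 - lambda2]. The matrix
    [N = (P - r1)(P - r2)] satisfies [N P = N] by the Cayley-Hamilton theorem,
    hence [N P^n = N], and the flux of [N] vanishes because the flux of [P^2]
    is [(tr P - 1) nu = (r1 + r2) nu] ([flux_sqr]). Expanding [N P^n], the flux
    of [P^n] obeys the second-order recurrence with characteristic roots [r1]
    and [r2] and initial values 0 and [nu]; so does [nu] times
    [(r2^n - r1^n) / (lambda1 - lambda2)], including its limit when
    [lambda1 = lambda2]. *)

Set Implicit Arguments.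
Unset Strict Implicit.
Unset Printing Implicit Defensive.

Import Order.TTheory GRing.Theory Num.Theory.

Local Open Scope classical_set_scope.
Local Open Scope ring_scope.
Local Open Scope complex_scope.

(** * The probability flux of a stationary three-state matrix *)

Lemma sum_ord3 (V : nmodType) (f : 'I_3 -> V) :
  \sum_x f x = f 0 + f 1 + f 2.
Proof.
rewrite !big_ord_recl big_ord0 addr0 -addrA.
by congr (f _ + (f _ + f _)); apply/val_inj.
Qed.

(** The net probability flow from state 1 to state 2 in one step of [X]. *)
Definition flux {F : comNzRingType} (mu : 'rV[F]_3) (X : 'M[F]_3) : F :=
  mu 0 0 * X 0 1 - mu 0 1 * X 1 0.

Lemma flux1 (F : comNzRingType) (mu : 'rV[F]_3) : flux mu 1 = 0.
Proof. by rewrite /flux !mxE !mulr0 subr0. Qed.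

Lemma fluxD (F : comNzRingType) (mu : 'rV[F]_3) X Y :
  flux mu (X + Y) = flux mu X + flux mu Y.
Proof. by rewrite /flux !mxE; ring. Qed.

Lemma fluxZ (F : comNzRingType) (mu : 'rV[F]_3) a X :
  flux mu (a *: X) = a * flux mu X.
Proof. by rewrite /flux !mxE; ring. Qed.

(** The left side of the hypothesis is [(x - 1) N], so multiplication by [x]
    fixes [N]. *)
Lemma mul_annihilator (F : comNzRingType) (A : algType F) (x : A)
    (r1 r2 : F) n :
  (x - 1) * ((x - r1%:A) * (x - r2%:A)) = 0 ->
  let N := x ^+ 2 + (- (r1 + r2)) *: x + (r1 * r2)%:A in N * x ^+ n = N.
Proof.
move=> annx N.
have NE : (x - r1%:A) * (x - r2%:A) = N.
  rewrite mulrBl !mulrBr -!scalerAl -!scalerAr !mul1r !mulr1 scalerA /N expr2.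
  rewrite opprB scaleNr scalerDl opprD !addrA [LHS]addrAC; congr (_ + _).
  by rewrite addrAC.
have xN : x * N = N.
  by apply/eqP; rewrite -subr_eq0 -{2}[N]mul1r -mulrBl -NE annx.
have Nx : N * x = x * N.
  rewrite mulrDl mulrDr mulrDl mulrDr -!scalerAl -!scalerAr mul1r mulr1.
  by rewrite -exprS -exprSr.
elim: n => [|n IHn]; first by rewrite mulr1.
by rewrite exprS mulrA Nx xN.
Qed.

Section FluxOfPowers.
Variables (F : comNzRingType) (mu : 'rV[F]_3) (P : 'M[F]_3).
Hypothesis row_sum1 : forall x, \sum_y P x y = 1.
Hypothesis muP : mu *m P = mu.

(** A two-step move from state 1 to state 2 either stays once in one of these
    states or passes through state 3; stationarity makes the net flows
    2 -> 3 and 3 -> 1 equal to the flow 1 -> 2, and this turns the paths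
    through 3 into a multiple of the flux. *)
Lemma flux_sqr : flux mu (P ^+ 2) = (\tr P - 1) * flux mu P.
Proof.
have bal y : \sum_x mu 0 x * P x y = mu 0 y * \sum_x P y x.
  by rewrite row_sum1 mulr1 -[in RHS]muP mxE.
(* The net flows 3 -> 1 and 2 -> 3 both equal the flux 1 -> 2. *)
have loop0 : mu 0 0 * P 0 2 = mu 0 2 * P 2 0 - flux mu P.
  have /eqP := bal 0; rewrite /flux !sum_ord3 -subr_eq0 => /eqP e.
  by apply/eqP; rewrite -subr_eq0 -oppr_eq0 -[X in _ == X]e; apply/eqP; ring.
have loop1 : mu 0 1 * P 1 2 = mu 0 2 * P 2 1 + flux mu P.
  have /eqP := bal 1; rewrite /flux !sum_ord3 -subr_eq0 => /eqP e.
  by apply/eqP; rewrite -subr_eq0 -oppr_eq0 -[X in _ == X]e; apply/eqP; ring.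
have -> : \tr P - 1 = P 0 0 + P 1 1 - P 2 0 - P 2 1.
  by rewrite /mxtrace sum_ord3 -(row_sum1 2) sum_ord3; ring.
transitivity (flux mu P * (P 0 0 + P 1 1)
   + (mu 0 0 * P 0 2 * P 2 1 - mu 0 1 * P 1 2 * P 2 0)).
  by rewrite expr2 -mulmxE /flux !mxE !sum_ord3; ring.
by rewrite loop0 loop1; ring.
Qed.

Variables r1 r2 : F.
Hypothesis trP : \tr P = 1 + r1 + r2.
Hypothesis annP : (P - 1) * ((P - r1%:A) * (P - r2%:A)) = 0.

(** With [N = (P - r1)(P - r2)], the recurrence says that the flux of
    [N P^n = N] is 0; the trace hypothesis makes the flux of [N] vanish. *)
Lemma flux_rec n :
  flux mu (P ^+ n.+2) =
  (r1 + r2) * flux mu (P ^+ n.+1) - r1 * r2 * flux mu (P ^+ n).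
Proof.
pose N := P ^+ 2 + (- (r1 + r2)) *: P + (r1 * r2)%:A.
have NP m : N * P ^+ m = N by apply: mul_annihilator.
have fN : flux mu N = 0.
  by rewrite !fluxD !fluxZ flux1 flux_sqr trP; ring.
have := NP n => /(congr1 (flux mu)); rewrite fN !mulrDl -exprD add2n.
rewrite -!scalerAl mul1r -exprS !fluxD !fluxZ => e.
apply/eqP; rewrite -subr_eq0 -[X in _ == X]e; apply/eqP; ring.
Qed.

End FluxOfPowers.

(** * The quotient of powers of the two eigenvalues *)

Section PowerQuotient.
Variables (R : realType) (l1 l2 : R[i]).

Lemma power_quotient0 : power_quotient l1 l2 0 = 0.
Proof. by rewrite /power_quotient !expr0 subrr !mul0r if_same. Qed.

Lemma power_quotient1 : power_quotient l1 l2 1 = 1.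
Proof.
rewrite /power_quotient; case: eqVneq => [_|ne]; first by rewrite mulr1.
have -> : (1 - l2) ^+ 1 - (1 - l1) ^+ 1 = l1 - l2 by ring.
by rewrite divff // subr_eq0.
Qed.

(** Powers of [1 - l1] and [1 - l2] solve the recurrence that has them as
    characteristic roots; in the case of a double root [r], the second solution
    is [n r^(n-1)]. *)
Lemma power_quotient_rec n : power_quotient l1 l2 n.+2 =
  ((1 - l1) + (1 - l2)) * power_quotient l1 l2 n.+1
  - (1 - l1) * (1 - l2) * power_quotient l1 l2 n.
Proof.
rewrite /power_quotient; case: eqVneq => [<-|ne].
  case: n => [|n] /=; first by rewrite !expr0 expr1; ring.
  by rewrite !exprS -[n.+3]addn3 -[n.+2]addn2 -[n.+1]addn1 !natrD; ring.
by rewrite !exprS; field; rewrite subr_eq0.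
Qed.

End PowerQuotient.

(** * Flux of the powers of the transition matrix *)

Lemma split_char_poly_annihilates (F : comNzRingType) n (Q : 'M[F]_n.+1)
    (a b : F) :
  char_poly Q = 'X * (('X + a%:P) * ('X + b%:P)) ->
  Q * ((Q + a%:A) * (Q + b%:A)) = 0.
Proof.
move=> charQ.
have hM p q : horner_mx Q (p * q) = horner_mx Q p * horner_mx Q q.
  exact: rmorphM.
have hD c : horner_mx Q ('X + c%:P) = Q + c%:A.
  by rewrite raddfD /= horner_mx_X horner_mx_C scalemx1.
have hX : horner_mx Q 'X = Q by exact: horner_mx_X.
by rewrite -[RHS](Cayley_Hamilton Q) charQ !hM hX !hD.
Qed.

Section Spectrum.
Variables (R : realType) (P : 'M[R]_3) (l1 l2 : R[i]).
Hypothesis eig : nonzero_eigenvalues (P - 1%:M) l1 l2.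
Let Pc := map_mx (real_complex R) P.

Let char_polyQ : char_poly (Pc - 1) = 'X * (('X + l1%:P) * ('X + l2%:P)).
Proof.
case: eig => _ _; rewrite map_mxB map_mx1 -/Pc => ->.
by rewrite !big_cons big_nil mulr1 !raddfN subr0 !opprK.
Qed.

Lemma trace_eigenvalues : \tr Pc = 1 + (1 - l1) + (1 - l2).
Proof.
have := char_poly_trace (Pc - 1) (isT : (0 < 3)%N).
rewrite char_polyQ coefXM /= mulrDl coefD coefXM coefCM /=.
rewrite !coefD !coefX !coefC /= addr0 add0r mulr1 raddfB /= mxtrace1 => e.
have -> : \tr Pc = 3%:R + - (\tr Pc - 3%:R) * -1 by ring.
by rewrite -e; ring.
Qed.

Lemma eigenvalues_annihilate :
  (Pc - 1) * ((Pc - (1 - l1)%:A) * (Pc - (1 - l2)%:A)) = 0.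
Proof.
have shift l : Pc - (1 - l)%:A = (Pc - 1) + l%:A.
  by rewrite scalerBl scale1r opprB addrA addrAC.
by rewrite !shift; exact: split_char_poly_annihilates char_polyQ.
Qed.

End Spectrum.

(** Both sides obey the same second-order recurrence, with the same initial
    values; it is run over the complex numbers because its characteristic roots
    need not be real. *)
Lemma flux_pow (R : realType) (P : 'M[R]_3) (mu : 'rV[R]_3) (l1 l2 : R[i]) n :
    (forall x, \sum_y P x y = 1) -> mu *m P = mu ->
    nonzero_eigenvalues (P - 1%:M) l1 l2 ->
  (flux mu (P ^+ n))%:C = (flux mu P)%:C * power_quotient l1 l2 n.
Proof.
move=> row_sum1 muP eig.
pose Pc := map_mx (real_complex R) P; pose muc := map_mx (real_complex R) mu.
have row_sum1c x : \sum_y Pc x y = 1.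
  by under eq_bigr do rewrite mxE; rewrite -rmorph_sum row_sum1 rmorph1.
have muPc : muc *m Pc = muc by rewrite -map_mxM muP.
have fluxE X : (flux mu X)%:C = flux muc (map_mx (real_complex R) X).
  by rewrite /flux !mxE rmorphB !rmorphM.
have fluxXE m : (flux mu (P ^+ m))%:C = flux muc (Pc ^+ m).
  by rewrite fluxE rmorphXn.
have rec := flux_rec row_sum1c muPc (trace_eigenvalues eig)
  (eigenvalues_annihilate eig).
suff: (flux mu (P ^+ n))%:C = (flux mu P)%:C * power_quotient l1 l2 n /\
  (flux mu (P ^+ n.+1))%:C = (flux mu P)%:C * power_quotient l1 l2 n.+1 by case.
rewrite (fluxE P) -/Pc.
elim: n => [|n [IH0 IH1]].
  rewrite !fluxXE power_quotient0 power_quotient1 mulr0 mulr1.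
  by split; first exact: flux1.
split=> //; move: IH0 IH1; rewrite !fluxXE rec => -> ->.
by rewrite power_quotient_rec; ring.
Qed.

Lemma row_sum1_pow (F : comNzRingType) m (X : 'M[F]_m.+1) :
  (forall x, \sum_y X x y = 1) -> forall n x, \sum_y (X ^+ n) x y = 1.
Proof.
move=> row_sum1; elim=> [|n IHn] x.
  rewrite (bigD1 x) //= big1 => [|y /negPf yx]; rewrite !mxE ?eqxx ?addr0 //.
  by rewrite eq_sym yx.
under eq_bigr do rewrite exprS -mulmxE mxE.
rewrite exchange_big -[RHS](row_sum1 x); apply: eq_bigr => z _.
by rewrite -mulr_sumr IHn mulr1.
Qed.

Lemma stationary_pow (F : comNzRingType) m (X : 'M[F]_m.+1) (mu : 'rV[F]_m.+1) :
  mu *m X = mu -> forall n, mu *m X ^+ n = mu.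
Proof.
move=> muX; elim=> [|n IHn]; first by rewrite expr0 mulmx1.
by rewrite exprS -mulmxE mulmxA muX.
Qed.

(** Antisymmetrizing the form produces the matrix [J], which is antisymmetric
    with zero row sums, hence equal to [flux mu X] times the circulation
    1 -> 2 -> 3 -> 1; the form of that circulation is [coefA]. *)
Lemma flux_form (R : realType) (mu : 'rV[R]_3) (X : 'M[R]_3) (u v : 'cV[R]_3) :
    (forall x, \sum_y X x y = 1) -> mu *m X = mu ->
  \sum_x \sum_y mu 0 x * u x 0 * X x y * v y 0
  - \sum_x \sum_y mu 0 x * v x 0 * X x y * u y 0 = flux mu X * coefA u v.
Proof.
move=> row_sum1 muX.
pose J x y := mu 0 x * X x y - mu 0 y * X y x.
have JC x y : J y x = - J x y by rewrite /J opprB.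
have J0 x : J x x = 0 by rewrite /J subrr.
have J_row x : \sum_y J x y = 0.
  rewrite sumrB -mulr_sumr row_sum1 mulr1 -[in X in X - _]muX mxE.
  by rewrite subrr.
have J02 : J 0 2 = - J 0 1.
  by have := J_row 0; rewrite sum_ord3 J0 add0r => /addr0_eq.
have J12 : J 1 2 = J 0 1.
  have := J_row 1; rewrite sum_ord3 J0 addr0 (JC 0 1) => /addr0_eq.
  by rewrite opprK => <-.
transitivity (\sum_x \sum_y u x 0 * J x y * v y 0).
  rewrite [X in _ - X]exchange_big -sumrB; apply: eq_bigr => x _.
  by rewrite -sumrB; apply: eq_bigr => y _; rewrite /J; ring.
have -> : flux mu X = J 0 1 by [].
rewrite !sum_ord3 !J0 (JC 0 2) (JC 1 2) (JC 0 1) J02 J12 /coefA; ring.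
Qed.

(** * Joint law of two observations of a hidden Markov model *)

Section FiniteProbability.
Variables (R : realType) (d : measure_display) (T : measurableType d).
Variable Pr : probability T R.

Lemma prob_ge0 (A : set T) : 0 <= prob Pr A.
Proof. by rewrite fine_ge0. Qed.

Lemma prob_le (A B : set T) : measurable A -> measurable B -> A `<=` B ->
  prob Pr A <= prob Pr B.
Proof.
by move=> mA mB sub; rewrite fine_le ?fin_num_measure// le_measure ?inE.
Qed.

(** The product rule, also when [B] is null: then both sides vanish, whatever
    the conditional probability is. *)
Lemma prob_setI_cond (A B : set T) (q : R) : measurable A -> measurable B ->
    (prob Pr B != 0 -> cond_prob Pr A B = q) ->
  prob Pr (A `&` B) = q * prob Pr B.
Proof.
move=> mA mB; have [B0 _|B0 /(_ isT) <-] := eqVneq (prob Pr B) 0; last first.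
  by rewrite /cond_prob divfK.
rewrite B0 mulr0; apply/eqP; rewrite eq_le prob_ge0 andbT -B0.
by apply: prob_le => //; exact: measurableI.
Qed.

Section Fibers.
Variables (I : finType) (X : T -> I).
Hypothesis mX : forall x, measurable [set w | X w = x].

Lemma prob_fibers (A : set T) (B : pred I) : measurable A ->
  prob Pr (A `&` [set w | B (X w)]) =
  \sum_(x | B x) prob Pr (A `&` [set w | X w = x]).
Proof.
move=> mA.
have mAX x : measurable (A `&` [set w | X w = x]) by exact: measurableI.
have -> : A `&` [set w | B (X w)] =
    \bigcup_(x in [set x | B x]) (A `&` [set w | X w = x]).
  apply/seteqP; split=> [w [Aw BX]|w [x Bx [Aw /= Xw]]]; first by exists (X w).
  by split=> //=; rewrite Xw.
rewrite /prob measure_fin_bigcup //; last first.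
- by move=> x y _ _ [w [[_ <-] [_ <-]]].
- exact: finite_finset.
rewrite (fsbigE (enum B)) ?enum_uniq //; last 2 first.
- by move=> x /=; rewrite mem_enum.
- by move=> x Bx; rewrite mem_enum -topredE /= Bx.
rewrite -sum_fine => [|x _]; last by rewrite fin_num_measure.
by rewrite big_enum_cond /=; apply: eq_bigl => x;
  apply/andP/idP => [[]//|Bx]; split=> //; exact: mem_set.
Qed.

Lemma prob_total (A : set T) : measurable A ->
  prob Pr A = \sum_x prob Pr (A `&` [set w | X w = x]).
Proof.
move=> mA; rewrite -(prob_fibers predT mA); congr prob.
by apply/seteqP; split=> [w //|w []].
Qed.

End Fibers.
End FiniteProbability.

Section ObservedPairs.
Variables (R : realType) (d : measure_display) (T : measurableType d).
Variables (Pr : probability T R) (K : nat).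
Variables (mu : 'rV[R]_3) (P : 'M[R]_3) (Pi : 'M[R]_(3, K)).
Variables (C : nat -> T -> 'I_3) (S : nat -> T -> 'I_K).
Hypothesis hmm : is_hmm Pr mu P Pi C S.

Let mC := hmm_measurable_hidden hmm.
Let mS := hmm_measurable_observed hmm.

(** The finite path type makes the histories the fibers of one map, so that
    probabilities can be summed over all of them. *)
Definition joint_path t (w : T) : {ffun 'I_t.+1 -> 'I_3 * 'I_K} :=
  [ffun u : 'I_t.+1 => (C u w, S u w)].

Definition hidden_part t (p : {ffun 'I_t.+1 -> 'I_3 * 'I_K}) u :=
  (p (inord u)).1.

Definition observed_part t (p : {ffun 'I_t.+1 -> 'I_3 * 'I_K}) u :=
  (p (inord u)).2.

Lemma joint_path_fiber t p : [set w | joint_path t w = p] =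
  history C S (hidden_part p) (observed_part p) t.+1.
Proof.
apply/seteqP; split=> w /=.
  by move=> <- u ut; rewrite /hidden_part /observed_part ffunE inordK.
move=> hw; apply/ffunP => u; rewrite ffunE.
have [-> ->] := hw u (ltn_ord u).
by rewrite /hidden_part /observed_part inord_val -surjective_pairing.
Qed.

Lemma measurable_history c s t : measurable (history C S c s t).
Proof.
have -> : history C S c s t =
    \bigcap_(u in `I_t) ([set w | C u w = c u] `&` [set w | S u w = s u]).
  by apply/seteqP; split=> w hw u /hw.
by apply: bigcap_measurableType => // u _; exact: measurableI.
Qed.

Let mpath t p : measurable [set w | joint_path t w = p].
Proof. by rewrite joint_path_fiber; exact: measurable_history. Qed.

(** The Markov property conditions on single histories; summing over the
    histories that end in the hidden state [x] extends it to every event of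
    the past that fixes the present state. *)
Lemma markov_event t (B : pred {ffun 'I_t.+1 -> 'I_3 * 'I_K}) x y :
    (forall p, B p -> hidden_part p t = x) ->
  prob Pr ([set w | C t.+1 w = y] `&` [set w | B (joint_path t w)]) =
  prob Pr [set w | B (joint_path t w)] * P x y.
Proof.
move=> Bx; rewrite (prob_fibers Pr (@mpath t)) // -[X in prob Pr X * _]setTI.
rewrite (prob_fibers Pr (@mpath t)) // mulr_suml; apply: eq_bigr => p Bp.
rewrite setTI joint_path_fiber mulrC -(Bx p Bp).
apply: prob_setI_cond => //; first exact: measurable_history.
exact: (hmm_markov hmm).
Qed.

(** Conditional independence of the observation from the past, extended from
    single histories to arbitrary events of the past. *)
Lemma emission_event t (B : pred {ffun 'I_t.+1 -> 'I_3 * 'I_K}) x k :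
  prob Pr ([set w | S t.+1 w = k] `&` [set w | B (joint_path t w)]
           `&` [set w | C t.+1 w = x]) =
  Pi x k * prob Pr ([set w | B (joint_path t w)] `&` [set w | C t.+1 w = x]).
Proof.
rewrite setIAC [in RHS]setIC !(prob_fibers Pr (@mpath t)) //; last first.
  exact: measurableI.
rewrite mulr_sumr; apply: eq_bigr => p Bp.
rewrite joint_path_fiber; set H := history _ _ _ _ _.
have mH : measurable H by exact: measurable_history.
have CH : prob Pr ([set w | C t.+1 w = x] `&` H) =
    cond_prob Pr H [set w | C t.+1 w = x] * prob Pr [set w | C t.+1 w = x].
  by rewrite setIC; exact: prob_setI_cond.
rewrite setIAC CH mulrA; apply: prob_setI_cond => //; first exact: measurableI.
by move=> Cx; rewrite (hmm_emission_indep hmm) // (hmm_emission hmm).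
Qed.

(** The forward variable of the hidden Markov model for the sole observation
    [S_0 = i]. *)
Definition forward (i : 'I_K) t : 'rV[R]_3 :=
  \row_x prob Pr [set w | S 0%N w = i /\ C t w = x].

Let measurable_forward i t x : measurable [set w | S 0%N w = i /\ C t w = x].
Proof. exact: (measurableI _ _ (mS 0 i) (mC t x)). Qed.

Lemma forward0 i : forward i 0 = \row_x (Pi x i * mu 0 x).
Proof.
apply/rowP => x; rewrite !mxE -(hmm_initial hmm).
apply: (prob_setI_cond (mS 0 i) (mC 0 x)); exact: (hmm_emission hmm).
Qed.

Lemma forwardS i t : forward i t.+1 = forward i t *m P.
Proof.
apply/rowP => y; rewrite !mxE (prob_total Pr (mC t)) //.
apply: eq_bigr => x _; rewrite mxE.
pose B (p : {ffun 'I_t.+1 -> 'I_3 * 'I_K}) :=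
  (observed_part p 0 == i) && (hidden_part p t == x).
have BE : [set w | S 0%N w = i /\ C t w = x] = [set w | B (joint_path t w)].
  apply/seteqP; split=> w /=;
    rewrite /B /observed_part /hidden_part !ffunE /= !inordK //.
    by case=> -> ->; rewrite !eqxx.
  by case/andP=> /eqP-> /eqP->.
rewrite BE -(markov_event y) -?BE; last by move=> p /andP[_ /eqP].
by congr prob; apply/seteqP; split=> w /=; tauto.
Qed.

Lemma forwardE i t : forward i t = (\row_x (Pi x i * mu 0 x)) *m P ^+ t.
Proof.
elim: t => [|t IHt]; first by rewrite forward0 expr0 mulmx1.
by rewrite forwardS IHt exprSr -mulmxE mulmxA.
Qed.

(** Advance the forward variable to time [n], then emit [j]. The case [n = 0]
    is excluded because there both observations are one and the same. *)
Lemma prob_observed_pair i j n : (0 < n)%N ->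
  prob Pr [set w | S 0%N w = i /\ S n w = j] =
  \sum_x \sum_y mu 0 x * Pi x i * (P ^+ n) x y * Pi y j.
Proof.
case: n => // t _; rewrite (prob_total Pr (mC t.+1)); last first.
  exact: (measurableI _ _ (mS 0 i) (mS t.+1 j)).
rewrite exchange_big; apply: eq_bigr => y _ /=.
pose B (p : {ffun 'I_t.+1 -> 'I_3 * 'I_K}) := observed_part p 0 == i.
have BE : [set w | S 0%N w = i] = [set w | B (joint_path t w)].
  by apply/seteqP; split=> w /=;
    rewrite /B /observed_part !ffunE /= inordK // => /eqP.
have := emission_event B y j; rewrite -BE.
have -> : [set w | S 0%N w = i] `&` [set w | C t.+1 w = y] =
   [set w | S 0%N w = i /\ C t.+1 w = y] by [].
have := congr1 (fun v : 'rV_3 => v 0 y) (forwardE i t.+1); rewrite !mxE => ->.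
have -> : [set w | S 0%N w = i /\ S t.+1 w = j] =
  [set w | S t.+1 w = j] `&` [set w | S 0%N w = i].
  by apply/seteqP; split=> w [].
move=> ->; rewrite mulr_sumr; apply: eq_bigr => x _; rewrite mxE; ring.
Qed.

End ObservedPairs.

(** * Time asymmetry of the observed process *)

Theorem proposition4p2 (R : realType) (d : measure_display)
    (T : measurableType d) (Pr : probability T R)
    (K : nat) (a2 a3 b1 b3 c1 c2 : R) (mu : 'rV[R]_3) (Pi : 'M[R]_(3, K))
    (C : nat -> T -> 'I_3) (S : nat -> T -> 'I_K) (lambda1 lambda2 : R[i])
    (P := trans_mx a2 a3 b1 b3 c1 c2)
    (nu := mu 0 0 * a2 - mu 0 1 * b1)
    (P_stochastic : stochastic P)
    (P_irreducible : irreducible_mx P)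
    (mu_stationary : stationary_distribution P mu)
    (Pi_stochastic : stochastic Pi)
    (CS_hmm : is_hmm Pr mu P Pi C S)
    (lambda_eig : nonzero_eigenvalues (P - 1%:M) lambda1 lambda2)
    (i j : 'I_K) (n : nat) (n_gt0 : (0 < n)%N) :
  (prob Pr [set w | S 0%N w = i /\ S n w = j]
   - prob Pr [set w | S 0%N w = j /\ S n w = i])%:C
  = (nu * coefA (col i Pi) (col j Pi))%:C * power_quotient lambda1 lambda2 n.
Proof.
have [_ row_sum1] := P_stochastic; have [_ _ muP] := mu_stationary.
rewrite !(prob_observed_pair CS_hmm) //.
have -> : nu = flux mu P by rewrite /flux !mxE.
rewrite rmorphM mulrAC -(flux_pow n row_sum1 muP lambda_eig) -rmorphM.
rewrite -(flux_form _ _ (row_sum1_pow row_sum1 n) (stationary_pow muP n)).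
by congr (_ - _)%:C; apply: eq_bigr => x _; apply: eq_bigr => y _; rewrite !mxE.
Qed.
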